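(* Let $x:I\subset\mathbb{R}\to\mathbb{E}^3$ be a twisted curve in $\mathbb{E}^3$, parametrized by arclength $s$. Then $x$ is a $T$-constant curve of second kind if and only if $$\left(\frac{\kappa_1'+m_0\kappa_1^3}{\kappa_1^2\kappa_2}\right)'-\frac{\kappa_2}{\kappa_1}=0$$ holds for some constant function $m_0$.
   Context: For a unit speed curve $x(s)$ in Euclidean 3-space $\mathbb{E}^3$, the Frenet frame $T=x'$, $N_1$, $N_2=T\times N_1$ and curvature $\kappa_1=\|x''\|>0$, torsion $\kappa_2$ satisfy $T'=\kappa_1N_1$, $N_1'=-\kappa_1T+\kappa_2N_2$, $N_2'=-\kappa_2N_1$; primes denote derivatives in arclength $s$. A curve is twisted if $\kappa_1$ and $\kappa_2$ are nowhere zero. The position vector is written $x=m_0T+m_1N_1+m_2N_2$ and decomposes as $x=x^T+x^N$ into its components tangential and normal to the curve. The curve is $T$-constant if $\|x^T\|$ is constant; it is $T$-constant of first kind if $\|x^T\|=0$, and of second kind otherwise.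
   Formalization: The constant m_0 must be nonzero (m_0=0 gives first kind, e.g. curves on a sphere centred at the origin) and equal to the tangential coefficient of x; for an arbitrary nonzero constant, the equation is equivalent to x being T-constant of second kind after a translation. *)

(* Defs.v *)
From HB Require Import structures.
From mathcomp Require Import all_boot all_order all_algebra.
From mathcomp Require Import all_classical all_reals all_analysis.
Import Order.TTheory GRing.Theory Num.Theory.
Import numFieldNormedType.Exports.

Set Implicit Arguments.
Unset Strict Implicit.
Unset Printing Implicit Defensive.

Local Open Scope ring_scope.
Local Open Scope classical_set_scope.

(* The library norm on 'rV[R]_3 is the sup norm: it is used only through the
   topology (for derivatives). Lengths are measured by [enorm]. *)
Definition dot (R : realType) (u v : 'rV[R]_3) : R :=
  \sum_(i < 3) u 0 i * v 0 i.

Definition enorm (R : realType) (u : 'rV[R]_3) : R := Num.sqrt (dot u u).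

(* The index arithmetic takes place in 'I_3, that is, modulo 3. *)
Definition cross (R : realType) (u v : 'rV[R]_3) : 'rV[R]_3 :=
  \row_(i < 3) (u 0 (i + 1) * v 0 (i + 2%:R) - u 0 (i + 2%:R) * v 0 (i + 1)).

Definition tangent (R : realType) (x : R -> 'rV[R]_3) : R -> 'rV[R]_3 := derive1 x.

Definition kappa1 (R : realType) (x : R -> 'rV[R]_3) (s : R) : R :=
  enorm (derive1n 2 x s).

Definition normal1 (R : realType) (x : R -> 'rV[R]_3) (s : R) : 'rV[R]_3 :=
  (kappa1 x s)^-1 *: derive1n 2 x s.

Definition normal2 (R : realType) (x : R -> 'rV[R]_3) (s : R) : 'rV[R]_3 :=
  cross (tangent x s) (normal1 x s).

(* The N2-coefficient in N1' = - kappa1 T + kappa2 N2. *)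
Definition kappa2 (R : realType) (x : R -> 'rV[R]_3) (s : R) : R :=
  dot (derive1 (normal1 x) s) (normal2 x s).

(* Four derivatives are exactly what is needed for kappa1'' and kappa2', hence
   for the derivative in [curvature_eq], to exist; smooth curves are covered. *)
Definition unit_speed_curve (R : realType) (I : set R) (x : R -> 'rV[R]_3) :
    Prop :=
  (forall (n : nat) (s : R), (n < 4)%N -> I s -> derivable (derive1n n x) s 1) /\
  (forall s : R, I s -> enorm (tangent x s) = 1).

Definition twisted (R : realType) (I : set R) (x : R -> 'rV[R]_3) : Prop :=
  forall s : R, I s -> kappa1 x s <> 0 /\ kappa2 x s <> 0.

(* The T-coefficient m0 in x = m0 T + m1 N1 + m2 N2; the frame is
   orthonormal. *)
Definition m0 (R : realType) (x : R -> 'rV[R]_3) (s : R) : R :=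
  dot (x s) (tangent x s).

Definition tangential_part (R : realType) (x : R -> 'rV[R]_3) (s : R) :
    'rV[R]_3 :=
  m0 x s *: tangent x s.

Definition T_constant (R : realType) (I : set R) (x : R -> 'rV[R]_3) : Prop :=
  exists c : R, forall s : R, I s -> enorm (tangential_part x s) = c.

Definition T_constant_first_kind (R : realType) (I : set R)
    (x : R -> 'rV[R]_3) : Prop :=
  forall s : R, I s -> enorm (tangential_part x s) = 0.

Definition T_constant_second_kind (R : realType) (I : set R)
    (x : R -> 'rV[R]_3) : Prop :=
  T_constant I x /\ ~ T_constant_first_kind I x.

Definition curvature_eq (R : realType) (x : R -> 'rV[R]_3) (c : R) (s : R) :
    Prop :=
  derive1 (fun t : R => (derive1 (kappa1 x) t + c * kappa1 x t ^+ 3)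
                        / (kappa1 x t ^+ 2 * kappa2 x t)) s
  - kappa2 x s / kappa1 x s = 0.

(* Main.v *)
Require Import Defs.
From HB Require Import structures.
From mathcomp Require Import all_boot all_order all_algebra ring.
From mathcomp Require Import all_classical all_reals all_analysis.
Import Order.TTheory GRing.Theory Num.Theory.
Import numFieldNormedType.Exports.

Local Open Scope ring_scope.
Local Open Scope classical_set_scope.

(** Write the position vector in the Frenet frame as
    [x = m0 T + m1 N1 + m2 N2], where [m0 = x.T], [m1 = x.N1], [m2 = x.N2].
    Differentiating these three dot products with the Frenet equations gives

      [m0' = 1 + k1 m1],   [m1' = - k1 m0 + k2 m2],   [m2' = - k2 m1].

    The tangential part has length [|m0|]. If [|m0|] is a nonzero constant,
    then [m0^2] is constant, so [2 m0 m0' = 0], hence [m0' = 0] and [m0] is a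
    constant [c <> 0] on the interval ([T_constant_second_kindP]). The first
    equation then gives [m1 = - 1/k1], the second gives
    [m2 = (k1' + c k1^3) / (k1^2 k2)], and the third becomes the curvature
    equation ([m0_const_curvature_eq]).

    Conversely, suppose the curvature equation holds for [c]. The vector field
    [y = c T - (1/k1) N1 + m2 N2], with [m2] given by the formula above, then
    satisfies [y' = T = x'], so [x - y] is a constant vector [p], and the
    translated curve [x - p = y] has tangential coefficient [c]
    ([curvature_eq_m0_const]). Since translations change neither the frame nor
    the curvatures, both clauses of the theorem follow.

    The analytic work is to show that the Frenet apparatus can be
    differentiated: four derivatives of [x] make [k1'], [N1'] and hence [k2]
    differentiable, and the Frenet equations come from expanding [N1'] in the
    orthonormal frame. *)

(** * Dot and cross products in dimension three *)

Lemma row3P {R : realType} (u v : 'rV[R]_3) :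
  u 0 0 = v 0 0 -> u 0 1 = v 0 1 -> u 0 2%:R = v 0 2%:R -> u = v.
Proof.
move=> u0 u1 u2; apply/rowP => -[[|[|[|//]]] lti].
- by rewrite (_ : Ordinal lti = 0) //; exact: val_inj.
- by rewrite (_ : Ordinal lti = 1) //; exact: val_inj.
- by rewrite (_ : Ordinal lti = 2%:R) //; exact: val_inj.
Qed.

Lemma dotE {R : realType} (u v : 'rV[R]_3) :
  dot u v = u 0 0 * v 0 0 + u 0 1 * v 0 1 + u 0 2%:R * v 0 2%:R.
Proof.
rewrite /dot !big_ord_recl big_ord0 addr0 addrA.
have -> : lift ord0 ord0 = 1 :> 'I_3 by exact: val_inj.
by have -> : lift ord0 (lift ord0 ord0) = 2%:R :> 'I_3 by exact: val_inj.
Qed.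

Lemma cross0E {R : realType} (u v : 'rV[R]_3) :
  cross u v 0 0 = u 0 1 * v 0 2%:R - u 0 2%:R * v 0 1.
Proof. by rewrite mxE !add0r. Qed.

Lemma cross1E {R : realType} (u v : 'rV[R]_3) :
  cross u v 0 1 = u 0 2%:R * v 0 0 - u 0 0 * v 0 2%:R.
Proof.
rewrite mxE (_ : 1 + 1 = 2%:R :> 'I_3); last exact: val_inj.
by rewrite (_ : 1 + 2%:R = 0 :> 'I_3) //; exact: val_inj.
Qed.

Lemma cross2E {R : realType} (u v : 'rV[R]_3) :
  cross u v 0 2%:R = u 0 0 * v 0 1 - u 0 1 * v 0 0.
Proof.
rewrite mxE (_ : 2%:R + 1 = 0 :> 'I_3); last exact: val_inj.
by rewrite (_ : 2%:R + 2%:R = 1 :> 'I_3) //; exact: val_inj.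
Qed.

Definition crossE {R : realType} := (@cross0E R, @cross1E R, @cross2E R).

Lemma dotC {R : realType} (u v : 'rV[R]_3) : dot u v = dot v u.
Proof. by rewrite !dotE; ring. Qed.

Lemma dotDl {R : realType} (u v w : 'rV[R]_3) :
  dot (u + v) w = dot u w + dot v w.
Proof. by rewrite !dotE !mxE; ring. Qed.

Lemma dotZl {R : realType} (a : R) (u v : 'rV[R]_3) :
  dot (a *: u) v = a * dot u v.
Proof. by rewrite !dotE !mxE; ring. Qed.

Lemma dotDr {R : realType} (u v w : 'rV[R]_3) :
  dot u (v + w) = dot u v + dot u w.
Proof. by rewrite !(dotC u) dotDl. Qed.

Lemma dotZr {R : realType} (a : R) (u v : 'rV[R]_3) :
  dot u (a *: v) = a * dot u v.
Proof. by rewrite !(dotC u) dotZl. Qed.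

Lemma dot_ge0 {R : realType} (u : 'rV[R]_3) : 0 <= dot u u.
Proof. by rewrite dotE !addr_ge0 // -expr2 sqr_ge0. Qed.

Lemma enorm_sqr {R : realType} (u : 'rV[R]_3) : enorm u ^+ 2 = dot u u.
Proof. by rewrite sqr_sqrtr // dot_ge0. Qed.

Lemma enormZ {R : realType} (a : R) (u : 'rV[R]_3) :
  enorm (a *: u) = `|a| * enorm u.
Proof.
by rewrite /enorm dotZl dotZr mulrA -expr2 sqrtrM ?sqr_ge0 // sqrtr_sqr.
Qed.

Lemma crossDr {R : realType} (u v w : 'rV[R]_3) :
  cross u (v + w) = cross u v + cross u w.
Proof. by apply: row3P; rewrite !(crossE, mxE); ring. Qed.

Lemma crossZr {R : realType} (a : R) (u v : 'rV[R]_3) :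
  cross u (a *: v) = a *: cross u v.
Proof. by apply: row3P; rewrite !(crossE, mxE); ring. Qed.

Lemma crossZl {R : realType} (a : R) (u v : 'rV[R]_3) :
  cross (a *: u) v = a *: cross u v.
Proof. by apply: row3P; rewrite !(crossE, mxE); ring. Qed.

Lemma crossvv {R : realType} (u : 'rV[R]_3) : cross u u = 0.
Proof. by apply: row3P; rewrite !(crossE, mxE); ring. Qed.

Lemma dot_cross_l {R : realType} (u v : 'rV[R]_3) : dot u (cross u v) = 0.
Proof. by rewrite !(dotE, crossE); ring. Qed.

Lemma dot_cross_r {R : realType} (u v : 'rV[R]_3) : dot v (cross u v) = 0.
Proof. by rewrite !(dotE, crossE); ring. Qed.

Lemma cross_cross {R : realType} (u v : 'rV[R]_3) :
  cross u (cross u v) = dot u v *: u - dot u u *: v.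
Proof. by apply: row3P; rewrite !(dotE, crossE, mxE); ring. Qed.

Lemma dot_cross_cross {R : realType} (u v : 'rV[R]_3) :
  dot (cross u v) (cross u v) = dot u u * dot v v - dot u v ^+ 2.
Proof. by rewrite !(dotE, crossE); ring. Qed.

(** The matrix [A] with rows [u], [v], [u x v] satisfies [A A^T = 1]. A
    one-sided inverse of a square matrix is two-sided, so [w = w A^T A], which
    is the expansion of [w] along the rows of [A]. *)
Lemma orthonormal_expansion {R : realType} (u v w : 'rV[R]_3) :
  dot u u = 1 -> dot v v = 1 -> dot u v = 0 ->
  w = dot w u *: u + dot w v *: v + dot w (cross u v) *: cross u v.
Proof.
move=> uu vv uv; set b := cross u v.
have bb : dot b b = 1 by rewrite dot_cross_cross uu vv uv expr0n subr0 mulr1.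
have ub : dot u b = 0 by exact: dot_cross_l.
have vb : dot v b = 0 by exact: dot_cross_r.
pose f (i : 'I_3) := if i == 0 then u else if i == 1 then v else b.
pose A : 'M[R]_3 := \matrix_i f i.
have AAT : A *m A^T = 1%:M.
  apply/matrixP => i j.
  have -> : (A *m A^T) i j = dot (f i) (f j).
    by rewrite !mxE; apply: eq_bigr => k _; rewrite !mxE.
  rewrite mxE /f; case: i j => [[|[|[|//]]] ?] [[|[|[|//]]] ?] /=;
    by rewrite ?(dotC v u) ?(dotC b u) ?(dotC b v) ?(uu, vv, bb, uv, ub, vb).
rewrite -[LHS]mulmx1 -(mulmx1C AAT) mulmxA; apply/rowP => k.
have -> : w *m A^T = \row_i dot w (f i).
  by apply/rowP => i; rewrite !mxE; apply: eq_bigr => j _; rewrite !mxE.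
by rewrite !mxE !big_ord_recl big_ord0 !mxE /f /= addr0 addrA.
Qed.

(** * Derivatives of vector-valued functions of a real variable *)

Lemma is_derive_rowP {R : realType} {n : nat} (u : R -> 'rV[R]_n)
    (du : 'rV[R]_n) (s : R) :
  is_derive s (1 : R) u du <->
  forall i, is_derive s (1 : R) (fun t => u t 0 i) (du 0 i).
Proof.
split=> [[der_u <-] i | der_u].
  have der_ui := (derivable_mxP u s 1).1 der_u 0 i.
  by apply: DeriveDef => //; rewrite derive_mx // mxE.
have u_derivable : derivable u s 1.
  by apply/derivable_mxP => i j; rewrite ord1; have [] := der_u j.
apply: DeriveDef => //; rewrite derive_mx //; apply/rowP => j.
by rewrite mxE; have [] := der_u j.
Qed.

Lemma is_derive_mul {R : realType} (f g : R -> R) (df dg s : R) :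
  is_derive s (1 : R) f df -> is_derive s (1 : R) g dg ->
  is_derive s (1 : R) (fun t => f t * g t) (df * g s + f s * dg).
Proof.
move=> der_f der_g; apply: is_derive_eq (is_deriveM der_f der_g) _.
by rewrite /GRing.scale /=; ring.
Qed.

Lemma is_derive_pow {R : realType} (f : R -> R) (n : nat) (df s : R) :
  is_derive s (1 : R) f df ->
  is_derive s (1 : R) (fun t => f t ^+ n) (n%:R * f s ^+ n.-1 * df).
Proof.
move=> der_f; have := is_deriveX n der_f.
by rewrite (_ : f ^+ n = fun t => f t ^+ n) // exprfctE.
Qed.

Lemma is_derive_scale {R : realType} {n : nat} (f : R -> R)
    (u : R -> 'rV[R]_n) (df s : R) (du : 'rV[R]_n) :
  is_derive s (1 : R) f df -> is_derive s (1 : R) u du ->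
  is_derive s (1 : R) (fun t => f t *: u t) (df *: u s + f s *: du).
Proof.
move=> der_f /is_derive_rowP der_u; apply/is_derive_rowP => i.
under eq_fun do rewrite mxE.
by rewrite !mxE; exact: is_derive_mul.
Qed.

Lemma is_derive_dot {R : realType} (u v : R -> 'rV[R]_3)
    (du dv : 'rV[R]_3) (s : R) :
  is_derive s (1 : R) u du -> is_derive s (1 : R) v dv ->
  is_derive s (1 : R) (fun t => dot (u t) (v t)) (dot du (v s) + dot (u s) dv).
Proof.
move=> /is_derive_rowP der_u /is_derive_rowP der_v.
under eq_fun do rewrite dotE.
have der i := is_derive_mul _ _ _ _ _ (der_u i) (der_v i).
apply: is_derive_eq (is_deriveD (is_deriveD (der 0) (der 1)) (der 2%:R)) _.
by rewrite !dotE; ring.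
Qed.

Lemma is_derive_cross {R : realType} (u v : R -> 'rV[R]_3)
    (du dv : 'rV[R]_3) (s : R) :
  is_derive s (1 : R) u du -> is_derive s (1 : R) v dv ->
  is_derive s (1 : R) (fun t => cross (u t) (v t))
    (cross du (v s) + cross (u s) dv).
Proof.
move=> /is_derive_rowP der_u /is_derive_rowP der_v.
apply/is_derive_rowP => i; under eq_fun do rewrite mxE.
have der j k := is_derive_mul _ _ _ _ _ (der_u j) (der_v k).
apply: is_derive_eq
  (is_deriveB (der (i + 1) (i + 2%:R)) (der (i + 2%:R) (i + 1))) _.
by rewrite !mxE; ring.
Qed.

(** The curvatures and the frame are only controlled on [I]. As [I] is open,
    equality on [I] is equality near each of its points, which is all that a
    derivative sees. *)
Lemma is_derive_eq_on {R : realType} {V : normedModType R} (I : set R)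
    (f g : R -> V) (df : V) (s : R) :
  open I -> I s -> (forall t, I t -> f t = g t) ->
  is_derive s (1 : R) f df -> is_derive s (1 : R) g df.
Proof.
move=> I_open Is fg; apply: near_eq_is_derive.
by apply: filterS (open_nbhs_nbhs (conj I_open Is)) => t /fg.
Qed.

Lemma derivable_is_derive {R : realType} {V : normedModType R} (f : R -> V)
    (s : R) :
  derivable f s 1 -> is_derive s (1 : R) f (derive1 f s).
Proof. by move=> der_f; apply: DeriveDef; rewrite // derive1E. Qed.

Lemma derivable_eq_on {R : realType} {V : normedModType R} (I : set R)
    (f g : R -> V) (s : R) :
  open I -> I s -> (forall t, I t -> f t = g t) ->
  derivable f s 1 -> derivable g s 1.
Proof.
move=> I_open Is fg /derivable_is_derive der_f.
by have [] := is_derive_eq_on _ _ _ _ _ I_open Is fg der_f.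
Qed.

Lemma is_derive_derive1 {R : realType} {V : normedModType R} (f : R -> V)
    (df : V) (s : R) :
  is_derive s (1 : R) f df -> derive1 f s = df.
Proof. by move=> [_ <-]; rewrite derive1E. Qed.

(** Differentiates the identities [T.T = 1], [N1.N1 = 1], [T.N1 = 0] and the
    constancy of [m0], which are known on [I] only. *)
Lemma is_derive_const_on {R : realType} {V : normedModType R} (I : set R)
    (f : R -> V) (k df : V) (s : R) :
  open I -> I s -> (forall t, I t -> f t = k) ->
  is_derive s (1 : R) f df -> df = 0.
Proof.
move=> I_open Is fk /is_derive_derive1 <-; apply: is_derive_derive1.
by apply: (is_derive_eq_on I (cst k)) => // t /fk ->.
Qed.

(** By the mean value theorem on the segment between [s] and [t], which lies in
    [I] because [I] is an interval. *)
Lemma is_derive0_cst_on {R : realType} (I : set R) (f : R -> R) (s t : R) :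
  is_interval I -> (forall r, I r -> is_derive r (1 : R) f 0) ->
  I s -> I t -> f s = f t.
Proof.
move=> I_itv der_f; wlog st : s t / s <= t => [hw Is It|Is It].
  by have [st|/ltW ts] := leP s t; [exact: hw | exact/esym/hw].
have I_st r : r \in `[s, t]%R -> I r.
  by rewrite in_itv /=; exact: I_itv.
have f_cont : {within `[s, t], continuous f}.
  apply: derivable_within_continuous => r /I_st /der_f [] //.
have I_oo r : r \in `]s, t[%R -> is_derive r (1 : R) f 0.
  by move=> r_st; apply/der_f/I_st; exact: subset_itv_oo_cc.
have [r _] := MVT_segment st I_oo f_cont.
by rewrite mul0r => /eqP; rewrite subr_eq0 => /eqP.
Qed.

Lemma is_derive0_cst_on_row {R : realType} {n : nat} (I : set R)
    (u : R -> 'rV[R]_n) (s t : R) :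
  is_interval I -> (forall r, I r -> is_derive r (1 : R) u 0) ->
  I s -> I t -> u s = u t.
Proof.
move=> I_itv der_u Is It; apply/rowP => i.
apply: (is_derive0_cst_on I (fun r => u r 0 i)) => // r /der_u.
by move/is_derive_rowP => /(_ i); rewrite mxE.
Qed.

(** * The Frenet apparatus *)

Lemma is_derive_derive1n {R : realType} (I : set R) (x : R -> 'rV[R]_3)
    (n : nat) (s : R) :
  unit_speed_curve I x -> (n < 4)%N -> I s ->
  is_derive s (1 : R) (derive1n n x) (derive1n n.+1 x s).
Proof. by move=> [x_der _] n4 Is; exact/derivable_is_derive/x_der. Qed.

Lemma is_derive_curve {R : realType} (I : set R) (x : R -> 'rV[R]_3) (s : R) :
  unit_speed_curve I x -> I s -> is_derive s (1 : R) x (tangent x s).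
Proof. by move=> x_unit Is; exact: is_derive_derive1n 0%N _ x_unit _ Is. Qed.

Lemma kappa1_gt0 {R : realType} (I : set R) (x : R -> 'rV[R]_3) (s : R) :
  twisted I x -> I s -> 0 < kappa1 x s.
Proof.
by move=> x_tw /x_tw[/eqP k_neq0 _]; rewrite lt0r k_neq0 sqrtr_ge0.
Qed.

Lemma is_derive_enorm {R : realType} (u : R -> 'rV[R]_3) (du : 'rV[R]_3)
    (s : R) :
  0 < enorm (u s) -> is_derive s (1 : R) u du ->
  is_derive s (1 : R) (fun t => enorm (u t)) (dot (u s) du / enorm (u s)).
Proof.
move=> u_gt0 der_u; have uu_gt0 : 0 < dot (u s) (u s) by rewrite -sqrtr_gt0.
have := is_derive1_comp (is_derive1_sqrt uu_gt0)
          (is_derive_dot _ _ _ _ _ der_u der_u).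
rewrite -/(enorm (u s)) => /is_derive_eq; apply.
by rewrite (dotC du); field; rewrite gt_eqF.
Qed.

Lemma is_derive_inv {R : realType} (f : R -> R) (df s : R) :
  f s != 0 -> is_derive s (1 : R) f df ->
  is_derive s (1 : R) (fun t => (f t)^-1) (- df / f s ^+ 2).
Proof.
move=> f_neq0 der_f; apply: is_derive_eq (is_deriveV f_neq0 der_f) _.
by rewrite /GRing.scale /=; field.
Qed.

(** Closed formulas for the derivatives of [kappa1] and [normal1], valid where
    [kappa1] does not vanish. They involve only [x^`(2)] and [x^`(3)], which can
    be differentiated once more, and so give access to second derivatives. *)
Definition kappa1' {R : realType} (x : R -> 'rV[R]_3) (s : R) : R :=
  dot (derive1n 2 x s) (derive1n 3 x s) / kappa1 x s.

Definition normal1' {R : realType} (x : R -> 'rV[R]_3) (s : R) : 'rV[R]_3 :=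
  (- kappa1' x s / kappa1 x s ^+ 2) *: derive1n 2 x s +
  (kappa1 x s)^-1 *: derive1n 3 x s.

Section Frenet.
Context {R : realType} {I : set R} {x : R -> 'rV[R]_3}.
Context (I_open : open I) (x_unit : unit_speed_curve I x)
  (x_twisted : twisted I x).

Let T := tangent x.
Let N1 := normal1 x.
Let N2 := normal2 x.
Let k1 := kappa1 x.
Let k2 := kappa2 x.

Let k1_gt0 s : I s -> 0 < k1 s.
Proof. exact: kappa1_gt0. Qed.

Let k1_neq0 s : I s -> k1 s != 0.
Proof. by move=> Is; rewrite gt_eqF // k1_gt0. Qed.

Lemma is_derive_kappa1 s : I s -> is_derive s (1 : R) k1 (kappa1' x s).
Proof.
move=> Is; apply: is_derive_enorm; first exact: k1_gt0.
exact: is_derive_derive1n Is.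
Qed.

Lemma derivable_kappa1' s : I s -> derivable (kappa1' x) s 1.
Proof.
move=> Is; have der2 := is_derive_derive1n _ _ 2 _ x_unit isT Is.
have der3 := is_derive_derive1n _ _ 3 _ x_unit isT Is.
by have [] := is_derive_mul _ _ _ _ _ (is_derive_dot _ _ _ _ _ der2 der3)
  (is_derive_inv _ _ _ (k1_neq0 _ Is) (is_derive_kappa1 _ Is)).
Qed.

Lemma derivable_derive1_kappa1 s : I s -> derivable (derive1 k1) s 1.
Proof.
move=> Is.
apply: (derivable_eq_on _ _ _ _ I_open Is _ (derivable_kappa1' _ Is)) => t It.
by rewrite (is_derive_derive1 _ _ _ (is_derive_kappa1 _ It)).
Qed.

Lemma is_derive_normal1 s : I s -> is_derive s (1 : R) N1 (normal1' x s).
Proof.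
move=> Is; apply: is_derive_scale (is_derive_derive1n _ _ 2 _ x_unit isT Is).
exact: is_derive_inv (k1_neq0 _ Is) (is_derive_kappa1 _ Is).
Qed.

Lemma derivable_derive1_normal1 s : I s -> derivable (derive1 N1) s 1.
Proof.
move=> Is; have der1 := is_derive_kappa1 _ Is.
have der2 := is_derive_derive1n _ _ 2 _ x_unit isT Is.
have der3 := is_derive_derive1n _ _ 3 _ x_unit isT Is.
have der1' := derivable_is_derive _ _ (derivable_kappa1' _ Is).
have kk_neq0 : k1 s * k1 s != 0 by rewrite mulf_neq0 // k1_neq0.
have der_c := is_derive_mul _ _ _ _ _ der1'
  (is_derive_inv (fun t => k1 t * k1 t) _ _ kk_neq0
     (is_derive_mul _ _ _ _ _ der1 der1)).
have der_d := is_derive_inv _ _ _ (k1_neq0 _ Is) der1.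
have [der _] := is_deriveB (is_derive_scale _ _ _ _ _ der_d der3)
  (is_derive_scale _ _ _ _ _ der_c der2).
apply: (derivable_eq_on _ _ _ _ I_open Is _ der) => t It.
rewrite (is_derive_derive1 _ _ _ (is_derive_normal1 _ It)).
by rewrite /normal1' addrC mulNr scaleNr expr2.
Qed.

Lemma is_derive_tangent s : I s -> is_derive s (1 : R) T (k1 s *: N1 s).
Proof.
move=> Is; rewrite scalerA divff ?k1_neq0 // scale1r.
exact: is_derive_derive1n 1%N _ x_unit _ Is.
Qed.

Lemma dot_tangent_tangent s : I s -> dot (T s) (T s) = 1.
Proof. by move=> Is; rewrite -enorm_sqr x_unit.2 // expr1n. Qed.

Lemma dot_normal1_normal1 s : I s -> dot (N1 s) (N1 s) = 1.
Proof.
move=> Is; rewrite dotZl dotZr -enorm_sqr -/(kappa1 x s) -/(k1 s).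
by field; exact: k1_neq0.
Qed.

Lemma dot_tangent_normal1 s : I s -> dot (T s) (N1 s) = 0.
Proof.
move=> Is; have derT := is_derive_tangent _ Is.
have := is_derive_const_on _ _ _ _ _ I_open Is dot_tangent_tangent
  (is_derive_dot _ _ _ _ _ derT derT).
rewrite dotZl dotZr (dotC (N1 s)) -mulrDr => /eqP.
rewrite mulf_eq0 (negPf (k1_neq0 _ Is)) /= -mulr2n mulrn_eq0 /=.
by move/eqP.
Qed.

(** Differentiating [N1.N1 = 1] and [T.N1 = 0] gives [N1'.N1 = 0] and
    [N1'.T = - T'.N1 = - k1]; the third coordinate of [N1'] in the orthonormal
    frame is [k2] by definition. *)
Lemma is_derive_normal1_frenet s :
  I s -> is_derive s (1 : R) N1 (- k1 s *: T s + k2 s *: N2 s).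
Proof.
move=> Is; have derT := is_derive_tangent _ Is.
have := is_derive_normal1 _ Is; set N1' := normal1' x s => derN.
have dNN := is_derive_const_on _ _ _ _ _ I_open Is dot_normal1_normal1
  (is_derive_dot _ _ _ _ _ derN derN).
have dTN := is_derive_const_on _ _ _ _ _ I_open Is dot_tangent_normal1
  (is_derive_dot _ _ _ _ _ derT derN).
have N'N : dot N1' (N1 s) = 0.
  move: dNN; rewrite (dotC (N1 s)) -mulr2n => /eqP.
  by rewrite mulrn_eq0 => /eqP.
have N'T : dot N1' (T s) = - k1 s.
  apply/eqP; rewrite -addr_eq0 dotC addrC -dTN dotZl.
  by rewrite (dot_normal1_normal1 _ Is) mulr1.
have N'B : dot N1' (cross (T s) (N1 s)) = k2 s.
  by rewrite /k2 /kappa2 (is_derive_derive1 _ _ _ derN).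
apply: (is_derive_eq derN).
have := orthonormal_expansion _ _ N1' (dot_tangent_tangent _ Is)
  (dot_normal1_normal1 _ Is) (dot_tangent_normal1 _ Is).
by rewrite N'T N'N N'B scale0r addr0.
Qed.

(** By the product rule for [N2 = T x N1]: the term [T' x N1] vanishes because
    [T'] is parallel to [N1], and [T x N1'] reduces to
    [k2 T x (T x N1) = - k2 N1]. *)
Lemma is_derive_normal2 s : I s -> is_derive s (1 : R) N2 (- k2 s *: N1 s).
Proof.
move=> Is; apply: is_derive_eq.
  exact: is_derive_cross (is_derive_tangent _ Is)
    (is_derive_normal1_frenet _ Is).
rewrite crossZl crossvv scaler0 add0r crossDr !crossZr crossvv scaler0 add0r.
rewrite cross_cross dot_tangent_tangent // dot_tangent_normal1 //.
by rewrite scale0r add0r scale1r scalerN scaleNr.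
Qed.

Lemma derivable_kappa2 s : I s -> derivable k2 s 1.
Proof.
move=> Is.
by have [] := is_derive_dot _ _ _ _ _
  (derivable_is_derive _ _ (derivable_derive1_normal1 _ Is))
  (is_derive_normal2 _ Is).
Qed.

End Frenet.

(** * Invariance under translations *)

Lemma derive1_subr {R : realType} {V : normedModType R} (f : R -> V) (p : V) :
  derive1 (fun t => f t - p) = derive1 f.
Proof.
apply/funext => s; rewrite /derive1.
by under eq_fun do rewrite opprB addrA subrK.
Qed.

Lemma derive1n_subr {R : realType} {V : normedModType R} (f : R -> V) (p : V)
    (n : nat) :
  derive1n n.+1 (fun t => f t - p) = derive1n n.+1 f.
Proof. by rewrite !derive1Sn derive1_subr. Qed.

Section Translation.
Context {R : realType} (I : set R) (x : R -> 'rV[R]_3) (p : 'rV[R]_3).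
Let y t := x t - p.

Lemma tangent_subr : tangent y = tangent x.
Proof. exact: derive1_subr. Qed.

Lemma kappa1_subr : kappa1 y = kappa1 x.
Proof. by rewrite /kappa1 derive1n_subr. Qed.

Lemma normal1_subr : normal1 y = normal1 x.
Proof. by rewrite /normal1 kappa1_subr derive1n_subr. Qed.

Lemma kappa2_subr : kappa2 y = kappa2 x.
Proof. by rewrite /kappa2 /normal2 normal1_subr tangent_subr. Qed.

Lemma curvature_eq_subr (c s : R) : curvature_eq y c s = curvature_eq x c s.
Proof. by rewrite /curvature_eq kappa1_subr kappa2_subr. Qed.

Lemma twisted_subr : twisted I x -> twisted I y.
Proof. by rewrite /twisted kappa1_subr kappa2_subr. Qed.

Lemma unit_speed_curve_subr : unit_speed_curve I x -> unit_speed_curve I y.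
Proof.
move=> [x_der x1]; split=> [[|n] s n4 Is|]; last by rewrite tangent_subr.
  by apply: derivableB; [exact: x_der 0%N _ _ _ | exact: derivable_cst].
by rewrite derive1n_subr; exact: x_der.
Qed.

End Translation.

(** * The tangential coefficient of the position vector *)

Lemma is_derive_m0 {R : realType} (I : set R) (x : R -> 'rV[R]_3) (s : R) :
  unit_speed_curve I x -> twisted I x -> I s ->
  is_derive s (1 : R) (m0 x) (1 + kappa1 x s * dot (x s) (normal1 x s)).
Proof.
move=> x_unit x_tw Is.
have der_x := is_derive_curve _ _ _ x_unit Is.
have der_T := is_derive_tangent x_unit x_tw _ Is.
apply: is_derive_eq (is_derive_dot _ _ _ _ _ der_x der_T) _.
by rewrite (dot_tangent_tangent x_unit _ Is) dotZr.
Qed.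

Lemma enorm_tangential_part {R : realType} (I : set R) (x : R -> 'rV[R]_3)
    (s : R) :
  unit_speed_curve I x -> I s -> enorm (tangential_part x s) = `|m0 x s|.
Proof. by move=> [_ x1] Is; rewrite enormZ x1 // mulr1. Qed.

(** The length of the tangential part determines [m0] up to sign only.
    Differentiating [m0^2 = c^2] gives [m0' = 0], as [m0] has no zero, so the
    sign cannot change along the interval. *)
Lemma T_constant_second_kindP {R : realType} (I : set R) (x : R -> 'rV[R]_3) :
  open I -> is_interval I -> I !=set0 -> unit_speed_curve I x -> twisted I x ->
  T_constant_second_kind I x <->
  exists c : R, c <> 0 /\ forall s : R, I s -> m0 x s = c.
Proof.
move=> I_open I_itv [s0 Is0] x_unit x_tw.
split=> [[[c m0c] m0_neq0]|[c [c_neq0 m0c]]].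
  have abs_m0 s : I s -> `|m0 x s| = c.
    by move=> Is; rewrite -(enorm_tangential_part I) // m0c.
  have c_neq0 : c != 0.
    apply/eqP => c0; apply: m0_neq0 => s Is.
    by rewrite m0c.
  have m0s_neq0 s : I s -> m0 x s != 0 by move=> Is; rewrite -normr_eq0 abs_m0.
  have der0 s : I s -> is_derive s (1 : R) (m0 x) 0.
    move=> Is; have der := is_derive_m0 _ _ _ x_unit x_tw Is.
    have sq t : I t -> m0 x t * m0 x t = c ^+ 2.
      by move=> It; rewrite -(abs_m0 _ It) -normrX ger0_norm ?sqr_ge0 // expr2.
    have := is_derive_const_on _ _ _ _ _ I_open Is sq
      (is_derive_mul _ _ _ _ _ der der).
    move: der; set d := (_ + _) => der dm.
    suff <- : d = 0 by [].
    apply/eqP; move/eqP: dm; rewrite (mulrC d) -mulr2n mulrn_eq0 /= mulf_eq0.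
    by rewrite (negPf (m0s_neq0 _ Is)).
  exists (m0 x s0); split; first exact/eqP/m0s_neq0.
  by move=> s Is; exact: (is_derive0_cst_on I).
split; first by exists `|c| => s Is; rewrite (enorm_tangential_part I) // m0c.
move=> /(_ _ Is0); rewrite (enorm_tangential_part I) // m0c //.
by move/eqP; rewrite normr_eq0 => /eqP.
Qed.

(** The coefficient [m2] of the position vector along [N2] when [m0] has the
    constant value [c]; [curvature_eq x c] says that its derivative is
    [kappa2 / kappa1]. *)
Definition binormal_coef {R : realType} (x : R -> 'rV[R]_3) (c t : R) : R :=
  (derive1 (kappa1 x) t + c * kappa1 x t ^+ 3) / (kappa1 x t ^+ 2 * kappa2 x t).

Lemma derivable_binormal_coef {R : realType} (I : set R) (x : R -> 'rV[R]_3)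
    (c s : R) :
  open I -> unit_speed_curve I x -> twisted I x -> I s ->
  derivable (binormal_coef x c) s 1.
Proof.
move=> I_open x_unit x_tw Is; have [/eqP k1_neq0 /eqP k2_neq0] := x_tw _ Is.
have der_k1 := is_derive_kappa1 x_unit x_tw _ Is.
have der_k1' := derivable_is_derive _ _
  (derivable_derive1_kappa1 I_open x_unit x_tw _ Is).
have der_k2 := derivable_is_derive _ _
  (derivable_kappa2 I_open x_unit x_tw _ Is).
have den_neq0 : kappa1 x s ^+ 2 * kappa2 x s != 0.
  by rewrite mulf_neq0 // expf_neq0.
have der_num := is_deriveD der_k1'
  (is_derive_mul _ _ _ _ _ (is_derive_cst c s 1)
     (is_derive_pow _ 3 _ _ der_k1)).
have der_den := is_derive_mul _ _ _ _ _ (is_derive_pow _ 2 _ _ der_k1) der_k2.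
by have [] := is_derive_mul _ _ _ _ _ der_num
  (is_derive_inv (fun t => kappa1 x t ^+ 2 * kappa2 x t) _ _ den_neq0 der_den).
Qed.

(** With [m0 = c], the relations [0 = 1 + k1 m1] and [m1' = - k1 c + k2 m2]
    determine [m1] and [m2], and [m2' = - k2 m1] is the curvature equation. *)
Lemma m0_const_curvature_eq {R : realType} (I : set R) (x : R -> 'rV[R]_3)
    (c : R) :
  open I -> unit_speed_curve I x -> twisted I x ->
  (forall s, I s -> m0 x s = c) -> forall s, I s -> curvature_eq x c s.
Proof.
move=> I_open x_unit x_tw m0c.
have m1E s : I s -> dot (x s) (normal1 x s) = - (kappa1 x s)^-1.
  move=> Is; have [/eqP k1_neq0 _] := x_tw _ Is.
  have := is_derive_const_on _ _ _ _ _ I_open Is m0c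
    (is_derive_m0 _ _ _ x_unit x_tw Is).
  move/eqP; rewrite addrC addr_eq0 => /eqP k1m1.
  by apply: (mulfI k1_neq0); rewrite k1m1 mulrN divff.
have m2E s : I s -> binormal_coef x c s = dot (x s) (normal2 x s).
  move=> Is; have [/eqP k1_neq0 /eqP k2_neq0] := x_tw _ Is.
  have der_k1 := is_derive_kappa1 x_unit x_tw _ Is.
  have der_x := is_derive_curve _ _ _ x_unit Is.
  have der_N1 := is_derive_normal1_frenet I_open x_unit x_tw _ Is.
  (* [m1'] computed in two ways, by the Frenet equation for [N1] and from
     [m1 = - 1/k1]; equating them and solving for [m2] gives the claim. *)
  have m1'_curve := is_derive_derive1 _ _ _
    (is_derive_dot _ _ _ _ _ der_x der_N1).
  have m1'_kappa := is_derive_derive1 _ _ _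
    (is_derive_eq_on _ _ _ _ _ I_open Is (fun t It => esym (m1E t It))
       (is_deriveN (is_derive_inv _ _ _ k1_neq0 der_k1))).
  move: m1'_curve; rewrite m1'_kappa.
  rewrite (dot_tangent_normal1 I_open x_unit x_tw _ Is) add0r.
  rewrite dotDr !dotZr -/(m0 x s) m0c // => m1'.
  rewrite /binormal_coef (is_derive_derive1 _ _ _ der_k1).
  apply: (mulfI k2_neq0); rewrite -[RHS](addKr (- kappa1 x s * c)) -m1'.
  by field; rewrite k1_neq0.
move=> s Is; have [/eqP k1_neq0 _] := x_tw _ Is.
have der_x := is_derive_curve _ _ _ x_unit Is.
have der_N2 := is_derive_normal2 I_open x_unit x_tw _ Is.
have m2E' t : I t -> dot (x t) (normal2 x t) = binormal_coef x c t by move/m2E.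
have der_m2 := is_derive_eq_on _ _ _ _ _ I_open Is m2E'
  (is_derive_dot _ _ _ _ _ der_x der_N2).
rewrite /curvature_eq -/(binormal_coef x c) (is_derive_derive1 _ _ _ der_m2).
rewrite (dot_cross_l (tangent x s)) dotZr m1E // add0r mulrNN.
exact: subrr.
Qed.

(** The curvature equation is what makes the field
    [y = c T - (1/k1) N1 + m2 N2] satisfy [y' = T]: the [N1] component of [y']
    vanishes by the choice of [m2] and the [N2] component by the equation. So
    [x] and [y] differ by a constant vector, which is the origin sought. *)
Lemma curvature_eq_m0_const {R : realType} (I : set R) (x : R -> 'rV[R]_3)
    (c : R) :
  open I -> is_interval I -> I !=set0 -> unit_speed_curve I x -> twisted I x ->
  (forall s, I s -> curvature_eq x c s) ->
  exists p : 'rV[R]_3, forall s, I s -> m0 (fun t => x t - p) s = c.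
Proof.
move=> I_open I_itv [s0 Is0] x_unit x_tw eq_c.
pose y s := c *: tangent x s - (kappa1 x s)^-1 *: normal1 x s
            + binormal_coef x c s *: normal2 x s.
have der_y s : I s -> is_derive s (1 : R) y (tangent x s).
  move=> Is; have [/eqP k1_neq0 /eqP k2_neq0] := x_tw _ Is.
  have der_k1 := is_derive_kappa1 x_unit x_tw _ Is.
  have der_T := is_derive_tangent x_unit x_tw _ Is.
  have der_N1 := is_derive_normal1_frenet I_open x_unit x_tw _ Is.
  have der_N2 := is_derive_normal2 I_open x_unit x_tw _ Is.
  have der_m2 := derivable_is_derive _ _
    (derivable_binormal_coef _ _ c _ I_open x_unit x_tw Is).
  have m2'E : derive1 (binormal_coef x c) s = kappa2 x s / kappa1 x s.
    by apply/eqP; rewrite -subr_eq0; apply/eqP; exact: eq_c.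
  have m2E : binormal_coef x c s * kappa2 x s =
             c * kappa1 x s + kappa1' x s / kappa1 x s ^+ 2.
    rewrite /binormal_coef (is_derive_derive1 _ _ _ der_k1).
    by field; rewrite k1_neq0 k2_neq0.
  apply: is_derive_eq
    (is_deriveD (is_deriveB
       (is_derive_scale _ _ _ _ _ (is_derive_cst c s 1) der_T)
       (is_derive_scale _ _ _ _ _ (is_derive_inv _ _ _ k1_neq0 der_k1) der_N1))
       (is_derive_scale _ _ _ _ _ der_m2 der_N2)) _.
  rewrite m2'E scale0r add0r /cst.
  (* [binormal_coef] enters the [N1] component only multiplied by [kappa2]. *)
  rewrite (scalerA (binormal_coef x c s)) mulrN m2E.
  by apply/rowP => i; rewrite !mxE; field.
have der_xy s : I s -> is_derive s (1 : R) (fun t => x t - y t) 0.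
  move=> Is; have der_x := is_derive_curve _ _ _ x_unit Is.
  by apply: is_derive_eq (is_deriveB der_x (der_y _ Is)) _; rewrite subrr.
exists (x s0 - y s0) => s Is.
have xy : x s - (x s0 - y s0) = y s.
  by rewrite (is_derive0_cst_on_row _ _ _ _ I_itv der_xy Is0 Is) subKr.
rewrite /m0 xy tangent_subr /y -scaleNr !dotDl.
rewrite (dotZl c) (dotZl (- _)) (dotZl (binormal_coef x c s)).
rewrite (dot_tangent_tangent x_unit _ Is) !(dotC _ (tangent x s)).
rewrite (dot_tangent_normal1 I_open x_unit x_tw _ Is).
by rewrite dot_cross_l !mulr0 !addr0 mulr1.
Qed.

(** * Curves of constant nonzero tangential length *)

(* First clause: m0 is the tangential coefficient of the position vector x.
   Second clause: the equation involves only the curvatures, so for an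
   arbitrary constant c it characterizes T-constancy up to the choice of the
   origin p. *)
Theorem theorem4 (R : realType) (I : set R) (x : R -> 'rV[R]_3)
    (I_open : open I) (I_itv : is_interval I) (I_neq0 : I !=set0)
    (x_unit : unit_speed_curve I x) (x_twisted : twisted I x) :
  (T_constant_second_kind I x <->
   exists c : R, [/\ c <> 0, forall s : R, I s -> m0 x s = c
                    & forall s : R, I s -> curvature_eq x c s]) /\
  ((exists p : 'rV[R]_3, T_constant_second_kind I (fun s : R => x s - p)) <->
   exists c : R, c <> 0 /\ forall s : R, I s -> curvature_eq x c s).
Proof.
have Tconst p := T_constant_second_kindP _ _ I_open I_itv I_neq0
  (unit_speed_curve_subr _ _ p x_unit) (twisted_subr _ _ p x_twisted).
split; split.
- move/(T_constant_second_kindP _ _ I_open I_itv I_neq0 x_unit x_twisted).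
  move=> [c [c_neq0 m0c]]; exists c; split=> //.
  exact: (m0_const_curvature_eq _ _ _ I_open x_unit x_twisted).
- move=> [c [c_neq0 m0c _]].
  apply/(T_constant_second_kindP _ _ I_open I_itv I_neq0 x_unit x_twisted).
  by exists c.
- move=> [p /Tconst [c [c_neq0 m0c]]]; exists c; split=> // s Is.
  rewrite -(curvature_eq_subr _ p).
  exact: (m0_const_curvature_eq I _ _ I_open
            (unit_speed_curve_subr _ _ _ x_unit)
            (twisted_subr _ _ _ x_twisted)).
- move=> [c [c_neq0 eq_c]].
  have [p m0c] := curvature_eq_m0_const _ _ _ I_open I_itv I_neq0 x_unit
    x_twisted eq_c.
  by exists p; apply/Tconst; exists c.
Qed.
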